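(* Let $L$, $M_0$, $P_0$ be operators of the form $X=X^{j}(\xi)\,\partial/\partial\xi^{j}$ that do not depend on $t$, and suppose $[L,P_0]=[L,M_0]$. Put $\mathcal{L}[A]=[L,A]$. Then a solution, regular at $t=0$, of the operator equations $$P_{tt}-\frac{1}{t}P_{t}+\mathcal{L}^{2}[P]=0,\qquad M_{tt}+\frac{1}{t}M_{t}+\mathcal{L}^{2}[M]=0$$ is given by $$P=\frac{t}{2}\,\mathbf{J_1}(t\mathcal{L}[P_0]),\qquad M=\mathbf{J_0}(t\mathcal{L}[M_0]),$$ and here $M_0(\xi)=M(t;\xi)|_{t=0}$.
   Context: The variables are $\xi=(\xi^1,\dots,\xi^N)$ ($N$ arbitrary) and $t$; subscripts $t$ denote derivatives with respect to $t$. Operators are first-order differential operators (vector fields) $X=X^{j}\,\partial/\partial\xi^{j}$ (summation over repeated indices), and $[\cdot,\cdot]$ is the commutator. For such an operator $A$, $\mathcal{L}[A]=[L,A]$, $\mathcal{L}^{0}[A]=A$ and $\mathcal{L}^{n}[A]=[L,[L,\dots,[L,A]\dots]]$ with $L$ appearing $n$ times. The following series are defined formally, i.e. as formal power series in $t$ whose coefficients are operators in $\xi$, differentiated in $t$ term by term: $$\mathbf{J_0}(t\mathcal{L}[M_0])=\sum_{m=0}^{\infty}\frac{(-1)^m}{(m!)^2}\left(\frac{t}{2}\right)^{2m}\mathcal{L}^{2m}[M_0],$$ $$\mathbf{J_1}(t\mathcal{L}[P_0])=\sum_{m=0}^{\infty}\frac{(-1)^m}{m!(m+1)!}\left(\frac{t}{2}\right)^{1+2m}\mathcal{L}^{1+2m}[P_0].$$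 ''Regular at $t=0$'' means that no negative powers of $t$ (or other singular terms) occur. *)

(* Defs.v *)
From HB Require Import structures.
From mathcomp Require Import all_boot all_order all_algebra.
From mathcomp Require Import all_classical all_reals all_analysis.

Set Implicit Arguments.
Unset Strict Implicit.
Unset Printing Implicit Defensive.

Import Order.TTheory GRing.Theory Num.Theory.
Import numFieldNormedType.Exports.

Local Open Scope classical_set_scope.
Local Open Scope ring_scope.

Section SmoothFunctions.
Variables (R : realType) (N : nat) (U : set 'rV[R]_N).
Implicit Types (f g : 'rV[R]_N -> R) (k : nat) (j : 'I_N).

Definition pderiv j f : 'rV[R]_N -> R :=
  fun x => if x \in U then 'D_(delta_mx 0 j) f x else 0.

(* A function on U is represented by its extension by zero, so that two
   functions on U are the same iff their representatives are equal.
   When U is open, the extension does not affect continuity or partial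
   derivatives at the points of U. *)
Fixpoint Ck k f : Prop :=
  [/\ forall x, ~ U x -> f x = 0,
      forall x, U x -> {for x, continuous f} &
      if k is k'.+1 then
        forall j, (forall x, U x -> derivable f x (delta_mx 0 j)) /\
                  Ck k' (pderiv j f)
      else True].

Definition smooth f : Prop := forall k, Ck k f.

Definition smooth_pred : {pred 'rV[R]_N -> R} := fun f => `[< smooth f >].

Lemma Ck_out k f : Ck k f -> forall x, ~ U x -> f x = 0.
Proof. by case: k => [|k] []. Qed.

Lemma Ck_cont k f : Ck k f -> forall x, U x -> {for x, continuous f}.
Proof. by case: k => [|k] []. Qed.

Lemma Ck_pred k f : Ck k.+1 f -> Ck k f.
Proof.
elim: k f => [|k IH] f [f0 cf df]; first by split.
by split=> // j; have [dfj /IH] := df j.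
Qed.

Lemma pderivD j f g :
  (forall x, U x -> derivable f x (delta_mx 0 j)) ->
  (forall x, U x -> derivable g x (delta_mx 0 j)) ->
  pderiv j (f + g) = pderiv j f + pderiv j g.
Proof.
move=> df dg; apply/funext => x; rewrite /pderiv [RHS]/=.
have -> : (pderiv j f + pderiv j g) x = pderiv j f x + pderiv j g x by [].
rewrite /pderiv; case: ifPn => [/set_mem Ux|_]; last by rewrite addr0.
by rewrite deriveD; [|exact: df|exact: dg].
Qed.

Lemma pderivZ j (a : R) f :
  (forall x, U x -> derivable f x (delta_mx 0 j)) ->
  pderiv j (a *: f) = a *: pderiv j f.
Proof.
move=> df; apply/funext => x.
have -> : (a *: pderiv j f) x = a * pderiv j f x by [].
rewrite /pderiv; case: ifPn => [/set_mem Ux|_]; last by rewrite mulr0.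
by rewrite deriveZ; [|exact: df].
Qed.

Lemma pderivM j f g :
  (forall x, U x -> derivable f x (delta_mx 0 j)) ->
  (forall x, U x -> derivable g x (delta_mx 0 j)) ->
  pderiv j (f * g) = f * pderiv j g + g * pderiv j f.
Proof.
move=> df dg; apply/funext => x.
have -> : (f * pderiv j g + g * pderiv j f) x =
          f x * pderiv j g x + g x * pderiv j f x by [].
rewrite /pderiv; case: ifPn => [/set_mem Ux|_]; last by rewrite !mulr0 addr0.
by rewrite deriveM; [|exact: df|exact: dg].
Qed.

Lemma Ck0 k : Ck k 0.
Proof.
elim: k => [|k IH]; (split; [by []|by move=> x _; exact: cst_continuous|])=> //.
move=> j; split; first by move=> x _; exact: derivable_cst.
suff -> : pderiv j 0 = 0 by [].
by apply/funext => x; rewrite /pderiv; case: ifP => // _; rewrite derive_cst.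
Qed.

Lemma CkD k f g : Ck k f -> Ck k g -> Ck k (f + g).
Proof.
elim: k f g => [|k IH] f g Cf Cg; split=> //.
- by move=> x Ux; rewrite -[LHS]/(f x + g x) (Ck_out Cf Ux) (Ck_out Cg Ux) addr0.
- by move=> x Ux; exact: cvgD (Ck_cont Cf Ux) (Ck_cont Cg Ux).
- by move=> x Ux; rewrite -[LHS]/(f x + g x) (Ck_out Cf Ux) (Ck_out Cg Ux) addr0.
- by move=> x Ux; exact: cvgD (Ck_cont Cf Ux) (Ck_cont Cg Ux).
move=> j; case: Cf => _ _ /(_ j)[df Cf]; case: Cg => _ _ /(_ j)[dg Cg].
split; last by rewrite pderivD //; exact: IH.
by move=> x Ux; apply: derivableD; [exact: df|exact: dg].
Qed.

Lemma CkZ k a f : Ck k f -> Ck k (a *: f).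
Proof.
elim: k f => [|k IH] f Cf; split=> //.
- by move=> x Ux; rewrite -[LHS]/(a * f x) (Ck_out Cf Ux) mulr0.
- by move=> x Ux; exact: cvgZr (Ck_cont Cf Ux).
- by move=> x Ux; rewrite -[LHS]/(a * f x) (Ck_out Cf Ux) mulr0.
- by move=> x Ux; exact: cvgZr (Ck_cont Cf Ux).
move=> j; case: Cf => _ _ /(_ j)[df Cf].
split; last by rewrite pderivZ //; exact: IH.
by move=> x Ux; apply: derivableZ; exact: df.
Qed.

Lemma CkM k f g : Ck k f -> Ck k g -> Ck k (f * g).
Proof.
elim: k f g => [|k IH] f g Cf Cg; split=> //.
- by move=> x Ux; rewrite -[LHS]/(f x * g x) (Ck_out Cf Ux) mul0r.
- by move=> x Ux; exact: cvgM (Ck_cont Cf Ux) (Ck_cont Cg Ux).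
- by move=> x Ux; rewrite -[LHS]/(f x * g x) (Ck_out Cf Ux) mul0r.
- by move=> x Ux; exact: cvgM (Ck_cont Cf Ux) (Ck_cont Cg Ux).
have [Cf' Cg'] := (Ck_pred Cf, Ck_pred Cg).
move=> j; case: Cf => _ _ /(_ j)[df Cf]; case: Cg => _ _ /(_ j)[dg Cg].
split; last by rewrite pderivM //; apply: CkD; exact: IH.
by move=> x Ux; apply: derivableM; [exact: df|exact: dg].
Qed.

Lemma smooth_submod : submod_closed smooth_pred.
Proof.
split; first by apply/asboolP => k; exact: Ck0.
move=> a f g /asboolP sf /asboolP sg; apply/asboolP => k.
by apply: CkD; [exact: CkZ|].
Qed.

Lemma smoothM f g : smooth f -> smooth g -> smooth (f * g).
Proof. by move=> sf sg k; exact: CkM. Qed.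

Lemma smooth_pderiv j f : smooth f -> smooth (pderiv j f).
Proof. by move=> sf k; case: (sf k.+1) => _ _ /(_ j)[]. Qed.

HB.instance Definition _ := GRing.isSubmodClosed.Build R ('rV[R]_N -> R)
  smooth_pred smooth_submod.

Record Cinfty : Type := MkCinfty {
  Cinfty_fun :> 'rV[R]_N -> R;
  CinftyP : Cinfty_fun \in smooth_pred }.

HB.instance Definition _ := [isSub for Cinfty_fun].
HB.instance Definition _ := [Choice of Cinfty by <:].
HB.instance Definition _ := [SubChoice_isSubLmodule of Cinfty by <:].

Definition Cmul (f g : Cinfty) : Cinfty :=
  MkCinfty (asboolT (smoothM (asboolW (CinftyP f)) (asboolW (CinftyP g)))).

Definition Cpderiv j (f : Cinfty) : Cinfty :=
  MkCinfty (asboolT (smooth_pderiv j (asboolW (CinftyP f)))).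

End SmoothFunctions.

Notation operator U := (Cinfty U -> Cinfty U).

Section Operators.
Variables (R : realType) (N : nat) (U : set 'rV[R]_N).

Definition vfield_op (X : 'I_N -> Cinfty U) : operator U :=
  fun f => \sum_(j < N) Cmul (X j) (Cpderiv j f).

Definition is_vfield (A : operator U) : Prop :=
  exists X : 'I_N -> Cinfty U, A = vfield_op X.

Definition commutator (A B : operator U) : operator U :=
  fun f => A (B f) - B (A f).

End Operators.

(* A formal series a in t, possibly with negative powers, is encoded by
   n |-> coefficient of t ^ n. *)
Notation fseries V := (int -> V).

Section FormalSeries.
Variables (R : realType) (V : lmodType R).
Implicit Types (a : fseries V) (v : V) (n k : int).

Definition ddt a : fseries V := fun n => (n + 1)%:~R *: a (n + 1).

Definition mul_tpow k a : fseries V := fun n => a (n - k).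

Definition regular a : Prop := forall n, n < 0 -> a n = 0.

(* (t / 2) ^ k v *)
Definition half_t_pow (k : nat) v : fseries V :=
  fun n => if n == k%:Z then (2^-1) ^+ k *: v else 0.

(* The sum over all m of S m, for families such that S m only involves powers
   t ^ k with k >= m: the coefficient of t ^ n then only receives
   contributions from m <= n. *)
Definition fsum (S : nat -> fseries V) : fseries V :=
  fun n => \sum_(0 <= m < `|n|.+1) S m n.

(* J_0(t ad[v]) and J_1(t ad[v]): the powers of ad apply to v alone. *)
Definition bessel_J0 (ad : V -> V) v : fseries V :=
  fsum (fun m => ((-1) ^+ m / (m`!%:R) ^+ 2) *:
                 half_t_pow (2 * m) (iter (2 * m) ad v)).

Definition bessel_J1 (ad : V -> V) v : fseries V :=
  fsum (fun m => ((-1) ^+ m / (m`!%:R * (m.+1)`!%:R)) *: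
                 half_t_pow (1 + 2 * m) (iter (1 + 2 * m) ad v)).

End FormalSeries.

(* Main.v *)
Require Import Defs.
From mathcomp Require Import all_boot all_order all_algebra.
From mathcomp Require Import all_classical all_reals all_analysis.
From mathcomp Require Import ring lra zify.
Import Order.TTheory GRing.Theory Num.Theory.
Import numFieldNormedType.Exports.
Local Open Scope classical_set_scope.
Local Open Scope ring_scope.

(** The two equations are instances of a'' + (s / t) a' + ad^2 a = 0, with
    s = 1 for M and s = -1 for P. On formal series this is a two-step
    recurrence: the coefficient of t ^ n is
    (n + 2) (n + 1 + s) a_(n+2) + ad^2 a_n. A series t ^ r (c_0 + c_1 t^2 + ...)
    solves it when r (r - 1 + s) = 0 and the c_m obey the recurrence
    ([frobenius_ode]). The Bessel series do: J_0 starts at r = 0 and (t / 2) J_1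
    at r = 2, and the recurrences come down to identities between factorials
    and powers of 2 ([bessel_J0_ode], [half_t_bessel_J1_ode]). This part is
    linear algebra, valid for any homogeneous map ad on a module.

    The other point is that all coefficients are first-order operators. They
    are multiples of iterated brackets, so it suffices that the bracket of two
    vector fields is again a vector field ([commutator_vfield_op]): its
    second-order part vanishes because second partial derivatives of smooth
    functions commute. That symmetry is obtained from the mean value theorem
    applied to the second difference of a function over a small parallelogram
    ([mixed_derivatives_eq]). *)

(** * Symmetry of mixed derivatives *)

Section MixedDerivatives.
Variables (R : realType) (V : normedModType R).
Implicit Types (f g k : V -> R) (x y u v : V) (s t h : R).

(** The difference quotients of s |-> f (y + s v) at s are those of f at
    y + s v in the direction v. *)
Lemma is_derive_line f g y v s :
  is_derive (y + s *: v) v f (g (y + s *: v)) ->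
  is_derive s 1 (fun s => f (y + s *: v)) (g (y + s *: v)).
Proof.
have E : (fun h : R => h^-1 *: (((fun s => f (y + s *: v)) \o shift s) (h *: 1) -
                            f (y + s *: v))) =
         (fun h => h^-1 *: ((f \o shift (y + s *: v)) (h *: v) - f (y + s *: v))).
  apply/funext => h /=.
  by rewrite [h *: 1]mulr1 scalerDl addrCA.
by case=> df Df; split; rewrite /derivable /derive E.
Qed.

Lemma mvt_line f g y v h : 0 <= h ->
  (forall s, 0 <= s <= h -> is_derive (y + s *: v) v f (g (y + s *: v))) ->
  exists2 c, 0 <= c <= h & f (y + h *: v) - f y = g (y + c *: v) * h.
Proof.
move=> h0 fg.
have fg' s : 0 <= s <= h -> is_derive s 1 (fun s => f (y + s *: v)) (g (y + s *: v)).
  by move=> /fg /is_derive_line.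
have [||c] := @MVT_segment R (fun s => f (y + s *: v))
                 (fun s => g (y + s *: v)) 0 h h0.
- by move=> s; rewrite in_itv /= => /andP[s0 sh]; apply: fg'; rewrite !ltW.
- apply: derivable_within_continuous => s; rewrite in_itv /= => /fg'.
  by case.
by rewrite in_itv /= scale0r addr0 subr0 => ch E; exists c.
Qed.

(** The second difference of f over the parallelogram spanned by h u and h v is
    the increment along u of the first difference in direction v. Applying the
    mean value theorem to that first difference in the direction u, and then to
    the derivative of f along u in the direction v, turns the second difference
    into a mixed derivative at an intermediate point, times h ^ 2. *)
Lemma mvt_second_difference f g k x u v h : 0 <= h ->
  (forall s t, 0 <= s <= h -> 0 <= t <= h ->
     is_derive (x + s *: u + t *: v) u f (g (x + s *: u + t *: v)) /\
     is_derive (x + s *: u + t *: v) v g (k (x + s *: u + t *: v))) ->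
  exists c d, [/\ 0 <= c <= h, 0 <= d <= h &
    f (x + h *: u + h *: v) - f (x + h *: u) - (f (x + h *: v) - f x) =
    k (x + c *: u + d *: v) * h ^+ 2].
Proof.
move=> h0 fgk.
have hh : 0 <= h <= h by rewrite h0 lexx.
have h00 : 0 <= (0 : R) <= h by rewrite h0 lexx.
pose F := fun p => f (p + h *: v) - f p.
pose G := fun p => g (p + h *: v) - g p.
have [s sh|c ch] := @mvt_line F G x u h h0.
  have [d1 _] := fgk s h sh hh.
  have [+ _] := fgk s 0 sh h00; rewrite scale0r addr0 => d2.
  apply: is_deriveB.
  (* The derivative of p |-> f (p + h v) at x + s u is that of f at
     x + s u + h v: both are limits of the same difference quotients. *)
  case: d1 => d1 D1; split.
    move: d1; rewrite /derivable /=.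
    by under eq_fun do rewrite addrA.
  rewrite -D1 /derive /=.
  by under [in RHS]eq_fun do rewrite addrA.
rewrite /F /G => E1.
have [t th|d dh E2] := @mvt_line g k (x + c *: u) v h h0.
  by have [] := fgk c t ch th.
exists c, d; split => //.
by rewrite E1 E2 expr2 mulrA.
Qed.

Lemma nbhs_parallelogram x u v (A : set V) : nbhs x A ->
  exists2 h, 0 < h & forall s t, 0 <= s <= h -> 0 <= t <= h ->
    A (x + s *: u + t *: v).
Proof.
move=> /nbhs_ballP[r /= r0 rA].
pose K := `|u| + `|v| + 1.
have K0 : 0 < K by rewrite /K ltr_wpDl // addr_ge0.
(* With 0 <= s, t <= h the displacement has norm at most h K, here r / 2. *)
exists (r / K / 2); first by rewrite !divr_gt0.
move=> s t /andP[s0 sh] /andP[t0 th]; apply: rA.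
rewrite -ball_normE /ball_ /= -addrA opprD addNKr normrN.
apply: (le_lt_trans (ler_normD _ _)); rewrite !normrZ (ger0_norm s0) (ger0_norm t0).
apply: (@le_lt_trans _ _ (r / K / 2 * (`|u| + `|v|))).
  by rewrite mulrDr lerD // ler_wpM2r.
apply: (@le_lt_trans _ _ (r / K / 2 * K)).
  rewrite ler_wpM2l //; first by rewrite !divr_ge0 // ltW.
  by rewrite /K lerDl.
have -> : r / K / 2 * K = r / 2 by field; rewrite gt_eqF.
lra.
Qed.

(** The second difference of f over a parallelogram at x is symmetric in u and
    v, so by [mvt_second_difference] the two mixed derivatives agree at two
    points (in general distinct) of any sufficiently small parallelogram;
    continuity at x brings both points back to x. *)
Theorem mixed_derivatives_eq f gu gv kuv kvu x u v :
  (\forall p \near x, is_derive p u f (gu p) /\ is_derive p v gu (kuv p)) ->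
  (\forall p \near x, is_derive p v f (gv p) /\ is_derive p u gv (kvu p)) ->
  {for x, continuous kuv} -> {for x, continuous kvu} ->
  kuv x = kvu x.
Proof.
move=> duv dvu cuv cvu; apply/eqP; rewrite -subr_eq0; apply/eqP.
apply/normr0_eq0/le_anti; rewrite normr_ge0 andbT.
apply/ler_addgt0Pl => e e0; rewrite addr0.
have e2 : 0 < e / 2 by rewrite divr_gt0.
have nuv : \forall p \near x, `|kuv x - kuv p| < e / 2.
  by apply: (cvgr_dist_lt _ _ cuv).
have nvu : \forall p \near x, `|kvu x - kvu p| < e / 2.
  by apply: (cvgr_dist_lt _ _ cvu).
have [h h0 hA] := nbhs_parallelogram x u v _
  (filterI (filterI duv dvu) (filterI nuv nvu)).
have h0' := ltW h0.
have [|c [d [ch dh E]]] := @mvt_second_difference f gu kuv x u v h h0'.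
  by move=> s t sh th; have [[]] := hA s t sh th.
have [|d' [c' [dh' ch' E']]] := @mvt_second_difference f gv kvu x v u h h0'.
  by move=> t s th sh; have [[]] := hA s t sh th; rewrite addrAC.
(* Both values are the same second difference divided by h ^ 2. *)
have kk : kuv (x + c *: u + d *: v) = kvu (x + c' *: u + d' *: v).
  have hn0 : h ^+ 2 != 0 by rewrite expf_neq0 // gt_eqF.
  apply: (mulIf hn0); rewrite -E [x + c' *: u + _]addrAC -E'.
  by rewrite [x + h *: v + _]addrAC; ring.
have [_ [n1 _]] := hA c d ch dh.
have [_ [_ n2]] := hA c' d' ch' dh'.
move: n1 n2; rewrite kk; set w := kvu (_ + _) => n1 n2.
have -> : kuv x - kvu x = (kuv x - w) + (w - kvu x) by ring.
apply: (le_trans (ler_normD _ _)); rewrite [`|w - _|]distrC; lra.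
Qed.

End MixedDerivatives.

(** * The Lie algebra of vector fields *)

Section VectorFields.
Variables (R : realType) (N : nat) (U : set 'rV[R]_N).
Implicit Types (f g h : Cinfty U) (a : R) (i j : 'I_N) (X Y : 'I_N -> Cinfty U).

Lemma Cinfty_ext f g : (forall x, f x = g x) -> f = g.
Proof. by move=> fg; apply/val_inj/funext. Qed.

Lemma CmulC f g : Cmul f g = Cmul g f.
Proof. by apply: Cinfty_ext => x; exact: mulrC. Qed.

Lemma CmulA f g h : Cmul f (Cmul g h) = Cmul (Cmul f g) h.
Proof. by apply: Cinfty_ext => x; exact: mulrA. Qed.

Lemma CmulDl f g h : Cmul (f + g) h = Cmul f h + Cmul g h.
Proof. by apply: Cinfty_ext => x; exact: mulrDl. Qed.

Lemma CmulZl a f g : Cmul (a *: f) g = a *: Cmul f g.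
Proof. by apply: Cinfty_ext => x; rewrite -[LHS]/(a * f x * g x) -mulrA. Qed.

Lemma Cinfty_derivable f j x : U x -> derivable f x (delta_mx 0 j).
Proof. by move: x; have [_ _ /(_ j)[]] := asboolW (CinftyP f) 1. Qed.

Lemma CpderivD j f g : Cpderiv j (f + g) = Cpderiv j f + Cpderiv j g.
Proof. by apply: val_inj; apply: pderivD => x; exact: Cinfty_derivable. Qed.

Lemma CpderivZ j a f : Cpderiv j (a *: f) = a *: Cpderiv j f.
Proof. by apply: val_inj; apply: pderivZ => x; exact: Cinfty_derivable. Qed.

Lemma CpderivM j f g :
  Cpderiv j (Cmul f g) = Cmul f (Cpderiv j g) + Cmul g (Cpderiv j f).
Proof. by apply: val_inj; apply: pderivM => x; exact: Cinfty_derivable. Qed.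

Lemma is_derive_Cpderiv f j x : U x -> is_derive x (delta_mx 0 j) f (Cpderiv j f x).
Proof.
move=> Ux; split; first exact: Cinfty_derivable.
by rewrite /= /pderiv mem_set.
Qed.

(** At a point of U the partial derivatives are taken over a neighbourhood
    contained in U, hence the openness; outside U both sides vanish. *)
Lemma CpderivC i j f : open U ->
  Cpderiv i (Cpderiv j f) = Cpderiv j (Cpderiv i f).
Proof.
move=> Uo; apply: Cinfty_ext => x.
have [Ux|nUx] := pselect (U x); last by rewrite /= /pderiv memNset.
have Un : \forall p \near x, U p by exact: open_nbhs_nbhs.
apply: (@mixed_derivatives_eq _ _ f (Cpderiv j f) (Cpderiv i f) _ _ x
          (delta_mx 0 j) (delta_mx 0 i)).
- by apply: filterS Un => p Up; split; exact: is_derive_Cpderiv.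
- by apply: filterS Un => p Up; split; exact: is_derive_Cpderiv.
- exact: Ck_cont (asboolW (CinftyP (Cpderiv i (Cpderiv j f))) 0) _ Ux.
- exact: Ck_cont (asboolW (CinftyP (Cpderiv j (Cpderiv i f))) 0) _ Ux.
Qed.

Lemma Cmul_sumr f (I : finType) (F : I -> Cinfty U) :
  Cmul f (\sum_k F k) = \sum_k Cmul f (F k).
Proof.
apply: (big_morph (Cmul f)) => [g h|]; first by rewrite !(CmulC f) CmulDl.
by apply: Cinfty_ext => x; exact: mulr0.
Qed.

Lemma vfield_opD X f g : vfield_op X (f + g) = vfield_op X f + vfield_op X g.
Proof.
rewrite /vfield_op -big_split /=; apply: eq_bigr => j _.
by rewrite CpderivD !(CmulC (X j)) CmulDl.
Qed.

Lemma vfield_opZ X a f : vfield_op X (a *: f) = a *: vfield_op X f.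
Proof.
rewrite /vfield_op scaler_sumr; apply: eq_bigr => j _.
by rewrite CpderivZ !(CmulC (X j)) CmulZl.
Qed.

Lemma vfield_opM X f g :
  vfield_op X (Cmul f g) = Cmul f (vfield_op X g) + Cmul g (vfield_op X f).
Proof.
rewrite /vfield_op !Cmul_sumr -big_split /=; apply: eq_bigr => j _.
rewrite CpderivM (CmulC (X j)) CmulDl.
by rewrite -!CmulA !(CmulC _ (X j)).
Qed.

Lemma vfield_op_sum X (I : finType) (F : I -> Cinfty U) :
  vfield_op X (\sum_k F k) = \sum_k vfield_op X (F k).
Proof.
apply: (big_morph (vfield_op X)) => [g h|]; first exact: vfield_opD.
by rewrite -(scale0r 0) vfield_opZ !scale0r.
Qed.

(** In the difference of the two compositions the second-order parts cancel:
    they are sums of Y_j X_i and X_j Y_i against the Hessian of the argument,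
    and the Hessian is symmetric. What remains is first-order. *)
Lemma commutator_vfield_op X Y : open U ->
  commutator (vfield_op X) (vfield_op Y) =
  vfield_op (fun j => vfield_op X (Y j) - vfield_op Y (X j)).
Proof.
move=> Uo; apply/funext => f; rewrite /commutator.
(* Leibniz' rule splits a composition into a second- and a first-order part. *)
have compE Z W : vfield_op Z (vfield_op W f) =
    \sum_j \sum_i Cmul (Cmul (W j) (Z i)) (Cpderiv i (Cpderiv j f)) +
    \sum_j Cmul (vfield_op Z (W j)) (Cpderiv j f).
  rewrite {2}/vfield_op vfield_op_sum -big_split /=; apply: eq_bigr => j _.
  rewrite vfield_opM [Cmul (Cpderiv j f) _]CmulC; congr (_ + _).
  by rewrite {1}/vfield_op Cmul_sumr; apply: eq_bigr => i _; rewrite CmulA.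
have symm : \sum_j \sum_i Cmul (Cmul (Y j) (X i)) (Cpderiv i (Cpderiv j f)) =
            \sum_j \sum_i Cmul (Cmul (X j) (Y i)) (Cpderiv i (Cpderiv j f)).
  rewrite exchange_big; apply: eq_bigr => j _; apply: eq_bigr => i _.
  by rewrite [Cmul (Y i) _]CmulC (CpderivC j i).
rewrite !compE symm opprD addrACA subrr add0r -sumrB [RHS]/vfield_op.
apply: eq_bigr => j _.
by rewrite CmulDl -(scaleN1r (vfield_op Y _)) CmulZl scaleN1r.
Qed.

Lemma is_vfield_commutator (A B : operator U) : open U ->
  is_vfield A -> is_vfield B -> is_vfield (commutator A B).
Proof.
by move=> Uo [X ->] [Y ->]; rewrite commutator_vfield_op //; eexists.
Qed.

Lemma is_vfieldZ a (A : operator U) : is_vfield A -> is_vfield (a *: A).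
Proof.
move=> [X ->]; exists (fun j => a *: X j); apply/funext => f.
rewrite -[LHS]/(a *: vfield_op X f) /vfield_op scaler_sumr.
by apply: eq_bigr => j _; rewrite CmulZl.
Qed.

Lemma is_vfield_iter n (A B : operator U) : open U ->
  is_vfield A -> is_vfield B -> is_vfield (iter n (commutator A) B).
Proof.
by move=> Uo vA vB; elim: n => //= n IH; exact: is_vfield_commutator.
Qed.

(** The bracket with a vector field is homogeneous on arbitrary operators,
    because a vector field is homogeneous on functions. *)
Lemma commutatorZ (A B : operator U) a :
  is_vfield A -> commutator A (a *: B) = a *: commutator A B.
Proof.
move=> [X ->]; apply/funext => f.
rewrite -[RHS]/(a *: commutator (vfield_op X) B f) /commutator.
by rewrite -[(a *: B) f]/(a *: B f) vfield_opZ scalerBr.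
Qed.

End VectorFields.

(** * Formal series solutions *)

Section Frobenius.
Variables (R : realType) (V : lmodType R).
Implicit Types (a : fseries V) (v : V) (n : int) (m r : nat).

(** As the exponents e are distinct, only the m-th term of the series reaches
    the power t ^ (e m); the bound k <= e k ensures that the partial sum which
    defines this coefficient goes far enough to contain that term. *)
Lemma fsum_half_t_pow_coef (c : nat -> R) (e : nat -> nat) (w : nat -> V) m :
  injective e -> (forall k, k <= e k)%N ->
  fsum (fun k => c k *: half_t_pow (e k) (w k)) (e m)%:Z =
  (c m * 2^-1 ^+ e m) *: w m.
Proof.
move=> einj ege; rewrite /fsum absz_nat.
rewrite (big_nat_widen _ _ (maxn (e m).+1 m.+1)) ?leq_maxl //.
rewrite big_mkord.
have mlt : (m < maxn (e m).+1 m.+1)%N by rewrite leq_max !ltnS leqnn orbT.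
rewrite (bigD1 (Ordinal mlt)) /=; last by rewrite ltnS.
rewrite big1 => [|i /andP[_ im]].
  rewrite addr0 -[LHS]/(c m *: half_t_pow (e m) (w m) (e m)%:Z).
  by rewrite /half_t_pow eqxx scalerA.
rewrite -[LHS]/(c i *: half_t_pow (e i) (w i) (e m)%:Z) /half_t_pow.
case: eqP => [[E]|_]; last by rewrite scaler0.
by case/eqP: im; apply/val_inj/einj.
Qed.

Lemma fsum_half_t_pow_eq0 (c : nat -> R) (e : nat -> nat) (w : nat -> V) n :
  (forall m, n <> (e m)%:Z) ->
  fsum (fun k => c k *: half_t_pow (e k) (w k)) n = 0.
Proof.
move=> ne; rewrite /fsum big1 // => i _.
rewrite -[LHS]/(c i *: half_t_pow (e i) (w i) n) /half_t_pow.
by case: eqP => [/ne//|_]; rewrite scaler0.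
Qed.

(** The operator D_t^2 + (s / t) D_t lowers the degree in t by two and acts
    diagonally on powers of t. *)
Lemma euler_operator_coef (s : R) a n :
  (ddt (ddt a) + s *: mul_tpow (-1) (ddt a)) n =
  ((n + 2)%:~R * ((n + 1)%:~R + s)) *: a (n + 2).
Proof.
rewrite -[LHS]/(ddt (ddt a) n + s *: mul_tpow (-1) (ddt a) n).
have -> : mul_tpow (-1) (ddt a) n = (n + 2)%:~R *: a (n + 2).
  by rewrite /mul_tpow /ddt; congr (_%:~R *: a _); lia.
have -> : ddt (ddt a) n = (n + 1)%:~R *: ((n + 2)%:~R *: a (n + 2)).
  by rewrite /ddt; congr (_ *: (_%:~R *: a _)); lia.
by rewrite !scalerA -scalerDl mulrDr mulrC [s * _]mulrC.
Qed.

(** Frobenius' method for a'' + (s / t) a' + T a = 0. A series with lowest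
    exponent r and steps of two is a solution as soon as r is a root of the
    indicial equation r (r - 1 + s) = 0, which removes the term t ^ (r - 2)
    produced by the lowest coefficient, and the coefficients satisfy the
    two-step recurrence. *)
Lemma frobenius_ode (T : V -> V) (s : R) r (c : nat -> V) a :
  T 0 = 0 ->
  r%:R * (r%:R - 1 + s) = 0 ->
  (forall m, a (r + 2 * m)%N%:Z = c m) ->
  (forall n, (forall m, n <> (r + 2 * m)%N%:Z) -> a n = 0) ->
  (forall m, ((r + 2 * m + 2)%:R * ((r + 2 * m + 1)%:R + s)) *: c m.+1 +
             T (c m) = 0) ->
  ddt (ddt a) + s *: mul_tpow (-1) (ddt a) + (T \o a) = 0.
Proof.
move=> T0 indicial ac a0 rec; apply/funext => n.
rewrite -[LHS]/((ddt (ddt a) + s *: mul_tpow (-1) (ddt a)) n + T (a n)).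
rewrite euler_operator_coef -[RHS]/(0 : V).
have [[m nE]|nn] := pselect (exists m, n = (r + 2 * m)%N%:Z).
  rewrite nE -(rec m) ac -(ac m.+1).
  by congr (_ *: a _ + _); lia.
rewrite (a0 n) => [|m nE]; last by apply: nn; exists m.
rewrite T0 addr0.
(* Here T (a n) = 0, and a (n + 2) can only be nonzero if n + 2 = r. *)
have [n2|n2] := eqVneq (n + 2) r%:Z.
  have -> : n + 1 = r%:Z - 1 by lia.
  by rewrite n2 rmorphB /= -!pmulrn indicial scale0r.
rewrite (a0 (n + 2)) ?scaler0 // => m nE.
case: m nE => [|m] nE; first by move/eqP: n2; apply; lia.
by apply: nn; exists m; lia.
Qed.

End Frobenius.

Section BesselEquations.
Variables (R : realType) (V : lmodType R) (ad : V -> V).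
Implicit Types (v : V) (n : int) (m : nat).
Hypothesis adZ : forall (a : R) v, ad (a *: v) = a *: ad v.

Let ad20 : (ad \o ad) 0 = 0.
Proof. by rewrite /= -(scale0r 0) !adZ !scale0r. Qed.

Definition half_t_bessel_J1 v : fseries V := 2^-1 *: mul_tpow 1 (bessel_J1 ad v).

Lemma bessel_J0_coef v m :
  bessel_J0 ad v (2 * m)%N%:Z =
  ((-1) ^+ m / m`!%:R ^+ 2 * 2^-1 ^+ (2 * m)) *: iter (2 * m) ad v.
Proof.
apply: (@fsum_half_t_pow_coef _ _ _ (fun m => (2 * m)%N)
          (fun m => iter (2 * m) ad v)) => [i j|k]; lia.
Qed.

Lemma bessel_J0_eq0 v n : (forall m, n <> (2 * m)%N%:Z) -> bessel_J0 ad v n = 0.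
Proof.
move=> ne.
exact: (@fsum_half_t_pow_eq0 _ _ _ (fun m => (2 * m)%N)
          (fun m => iter (2 * m) ad v)).
Qed.

Lemma bessel_J1_coef v m :
  bessel_J1 ad v (1 + 2 * m)%N%:Z =
  ((-1) ^+ m / (m`!%:R * m.+1`!%:R) * 2^-1 ^+ (1 + 2 * m)) *:
  iter (1 + 2 * m) ad v.
Proof.
apply: (@fsum_half_t_pow_coef _ _ _ (fun m => (1 + 2 * m)%N)
          (fun m => iter (1 + 2 * m) ad v)) => [i j|k]; lia.
Qed.

Lemma bessel_J1_eq0 v n :
  (forall m, n <> (1 + 2 * m)%N%:Z) -> bessel_J1 ad v n = 0.
Proof.
move=> ne.
exact: (@fsum_half_t_pow_eq0 _ _ _ (fun m => (1 + 2 * m)%N)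
          (fun m => iter (1 + 2 * m) ad v)).
Qed.

Lemma half_t_bessel_J1_coef v m :
  half_t_bessel_J1 v (2 + 2 * m)%N%:Z =
  ((-1) ^+ m / (m`!%:R * m.+1`!%:R) * 2^-1 ^+ (2 + 2 * m)) *:
  iter (1 + 2 * m) ad v.
Proof.
rewrite -[LHS]/(2^-1 *: bessel_J1 ad v ((2 + 2 * m)%N%:Z - 1)).
have -> : (2 + 2 * m)%N%:Z - 1 = (1 + 2 * m)%N%:Z by lia.
by rewrite bessel_J1_coef scalerA mulrCA -exprS.
Qed.

Lemma half_t_bessel_J1_eq0 v n :
  (forall m, n <> (2 + 2 * m)%N%:Z) -> half_t_bessel_J1 v n = 0.
Proof.
move=> ne; rewrite -[LHS]/(2^-1 *: bessel_J1 ad v (n - 1)).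
by rewrite bessel_J1_eq0 ?scaler0 // => m nE; apply: (ne m); lia.
Qed.

(** For s = 1 the indicial equation r ^ 2 = 0 has the root r = 0, and the
    recurrence is c_(m+1) = - ad^2 c_m / (2 m + 2) ^ 2. *)
Lemma bessel_J0_ode v (M := bessel_J0 ad v) :
  ddt (ddt M) + mul_tpow (-1) (ddt M) + (ad \o ad \o M) = 0.
Proof.
rewrite -[mul_tpow _ _]scale1r.
apply: (@frobenius_ode _ _ _ _ 0 _ _ ad20 _ (bessel_J0_coef v) (@bessel_J0_eq0 v)).
  by rewrite mul0r.
move=> m; have -> : (2 * m.+1 = (2 * m).+2)%N by lia.
rewrite -[(ad \o ad) _]/(ad (ad _)) !adZ -!iterS.
rewrite scalerA -scalerDl; set c := (X in X *: _).
suff -> : c = 0 by rewrite scale0r.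
rewrite /c !exprS !factS -natr1.
have fm : m`!%:R != 0 :> R by rewrite pnatr_eq0 -lt0n fact_gt0.
have m1 : m%:R + 1 != 0 :> R by rewrite natr1 pnatr_eq0.
by field; rewrite fm addrC.
Qed.

(** For s = -1 the indicial equation r (r - 2) = 0 has the root r = 2, the
    lowest exponent of (t / 2) J_1, and the recurrence is
    c_(m+1) = - ad^2 c_m / ((2 m + 2) (2 m + 4)). *)
Lemma half_t_bessel_J1_ode v (P := half_t_bessel_J1 v) :
  ddt (ddt P) - mul_tpow (-1) (ddt P) + (ad \o ad \o P) = 0.
Proof.
rewrite -[- mul_tpow _ _]scaleN1r.
apply: (@frobenius_ode _ _ _ _ 2 _ _ ad20 _ (half_t_bessel_J1_coef v)
          (@half_t_bessel_J1_eq0 v)).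
  by ring.
move=> m; have -> : (2 * m.+1 = (2 * m).+2)%N by lia.
rewrite -[(ad \o ad) _]/(ad (ad _)) !adZ -!iterS.
rewrite scalerA -scalerDl; set c := (X in X *: _).
suff -> : c = 0 by rewrite scale0r.
rewrite /c !exprS !factS ?(natrM, natrD) -!natr1.
have fm : m`!%:R != 0 :> R by rewrite pnatr_eq0 -lt0n fact_gt0.
have m1 : m%:R + 1 != 0 :> R by rewrite natr1 pnatr_eq0.
have m2 : m%:R + 1 + 1 != 0 :> R by rewrite !natr1 pnatr_eq0.
by field; rewrite fm m1.
Qed.

End BesselEquations.

(** * The operator equations *)

Theorem proposition3p1 (R : realType) (N : nat) (U : set 'rV[R]_N)
    (L M0 P0 : operator U) :
  open U ->
  is_vfield L -> is_vfield M0 -> is_vfield P0 ->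
  commutator L P0 = commutator L M0 ->
  let ad : operator U -> operator U := commutator L in
  let P : fseries (operator U) := 2^-1 *: mul_tpow 1 (bessel_J1 ad P0) in
  let M : fseries (operator U) := bessel_J0 ad M0 in
  [/\ (forall n, is_vfield (P n)) /\ (forall n, is_vfield (M n)),
      regular P /\ regular M,
      ddt (ddt P) - mul_tpow (-1) (ddt P) + (ad \o ad \o P) = 0,
      ddt (ddt M) + mul_tpow (-1) (ddt M) + (ad \o ad \o M) = 0 &
      M 0 = M0].
Proof.
move=> Uo vL vM0 vP0 _ ad P M.
have adZ a B : ad (a *: B) = a *: ad B by exact: commutatorZ.
have vf0 : is_vfield (0 : operator U).
  by rewrite -(scale0r L); exact: is_vfieldZ.
split.
- split=> n.
    have [[m ->]|nn] := pselect (exists m, n = (2 + 2 * m)%N%:Z).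
      rewrite -[P]/(half_t_bessel_J1 R _ ad P0) half_t_bessel_J1_coef.
      by apply: is_vfieldZ; exact: is_vfield_iter.
    suff -> : P n = 0 by [].
    by apply: half_t_bessel_J1_eq0 => m nE; apply: nn; exists m.
  have [[m ->]|nn] := pselect (exists m, n = (2 * m)%N%:Z).
    by rewrite [M _]bessel_J0_coef; apply: is_vfieldZ; exact: is_vfield_iter.
  by rewrite [M n]bessel_J0_eq0 // => m nE; apply: nn; exists m.
- split=> n n0; first by apply: half_t_bessel_J1_eq0 => m; lia.
  by apply: bessel_J0_eq0 => m; lia.
- exact: half_t_bessel_J1_ode.
- exact: bessel_J0_ode.
- rewrite [LHS](bessel_J0_coef R _ ad M0 0).
  by rewrite !expr0 fact0 expr1n divr1 mulr1 scale1r.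
Qed.
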